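(* Let $A=(a_{ij})$ be a real symmetric $n\times n$ matrix with constant row and column sums and a constant diagonal, and let $B=(b_{ij})$ be any real $n\times n$ matrix. Let $f:S_n\to\mathbb{R}$ be defined by $$f(\sigma)=\sum_{i,j=1}^n b_{\sigma(i)\sigma(j)}\,a_{ij},$$ let $\overline f=\frac1{n!}\sum_{\sigma\in S_n}f(\sigma)$ and $f_0=f-\overline f$. Let $\tau\in S_n$ satisfy $f_0(\tau)=\max_{\sigma\in S_n}f_0(\sigma)$. Let $k$ be an integer with $3\le k\le n-5$, let $0<\gamma<1$, and let $$\beta(n,k)=\frac{k^2-3k}{n^2-3n}.$$ Then the probability that a uniformly random permutation $\sigma\in S_n$ satisfies $$f_0(\sigma)\ge\gamma\,\beta(n,k)\,f_0(\tau)$$ is at least $$\frac{(1-\gamma)\,\beta(n,k)}{3\,k!}.$$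
   Context: $S_n$ is the group of permutations of $\{1,\dots,n\}$. ''Constant row and column sums'' means there is a number $a$ with $\sum_{i}a_{ij}=a$ for all $j$ and $\sum_j a_{ij}=a$ for all $i$; ''constant diagonal'' means there is a number $b$ with $a_{ii}=b$ for all $i$. *)

(* Defs.v *)
From mathcomp Require Import all_boot all_order all_fingroup all_algebra.

Set Implicit Arguments.
Unset Strict Implicit.
Unset Printing Implicit Defensive.

Import Order.TTheory GRing.Theory Num.Theory.
Local Open Scope ring_scope.

Definition symmetric_mx (R : realFieldType) (n : nat) (A : 'M[R]_n) : Prop :=
  forall i j, A i j = A j i.

Definition constant_row_col_sums (R : realFieldType) (n : nat) (A : 'M[R]_n) :
    Prop :=
  exists a : R,
    (forall j, \sum_i A i j = a) /\ (forall i, \sum_j A i j = a).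

Definition constant_diagonal (R : realFieldType) (n : nat) (A : 'M[R]_n) :
    Prop :=
  exists b : R, forall i, A i i = b.

Definition qap (R : realFieldType) (n : nat) (A B : 'M[R]_n) (s : 'S_n) : R :=
  \sum_i \sum_j B (s i) (s j) * A i j.

Definition perm_mean (R : realFieldType) (n : nat) (f : 'S_n -> R) : R :=
  (n`!%:R)^-1 * \sum_(s : 'S_n) f s.

Definition centered (R : realFieldType) (n : nat) (f : 'S_n -> R) (s : 'S_n) :
    R :=
  f s - perm_mean f.

Definition perm_prob (R : realFieldType) (n : nat) (P : pred 'S_n) : R :=
  #|[set s : 'S_n | P s]|%:R / #|{: 'S_n}|%:R.

Definition beta (R : realFieldType) (n k : nat) : R :=
  (k%:R ^+ 2 - 3 * k%:R) / (n%:R ^+ 2 - 3 * n%:R).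

(* Main.v *)
Require Import Defs.
From mathcomp Require Import all_boot all_order all_fingroup all_algebra.
From mathcomp Require Import ring lra zify.

(* Subtracting a multiple of the all-ones matrix and of the identity from [A]
   only changes [f] by a constant, so [A] may be taken hollow with zero row
   sums, and then [f_0 = f].  Averaging [f] over the conjugates of a permutation
   [w] with [k] fixed points and [t] two-cycles multiplies [f] at the identity
   by [(k^2 - 3k + 2t) / (n^2 - 3n)], the normalized character of the
   representation indexed by [(n-2, 2)].  Hence the mean of [f] over the
   permutations that agree with [tau] in exactly [k] points is at least
   [beta(n, k) f(tau)], and as [f <= f(tau)] a proportion
   [(1 - gamma) beta(n, k)] of them satisfies the bound.  By the Bonferroni
   inequalities, these permutations have density at least
   [(1 - 1 + 1/2 - 1/6) / k! = 1 / (3 k!)]. *)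

Set Implicit Arguments.
Unset Strict Implicit.
Unset Printing Implicit Defensive.

Import Order.TTheory GRing.Theory Num.Theory.
Local Open Scope ring_scope.

(** * Counting permutations with a prescribed number of fixed points *)

Definition fixpts (n : nat) (s : 'S_n) : {set 'I_n} := [set i | s i == i].

Definition perms_with_fixpts (n k : nat) : {set 'S_n} :=
  [set s | #|fixpts s| == k].

Lemma fixpts_conj n (s p : 'S_n) : #|fixpts (s ^ p)%g| = #|fixpts s|.
Proof.
have -> : fixpts (s ^ p)%g = [set p x | x in fixpts s].
  apply/setP=> i; rewrite -[i](permKV p); move: (p^-1%g i) => {}i.
  by rewrite mem_imset ?inE ?permJ ?(inj_eq perm_inj) //; apply: perm_inj.
by rewrite card_imset //; apply: perm_inj.
Qed.

(** Double counting of the pairs [(s, D)] where [D] is an [m]-subset fixed pointwise by [s]: each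
    [D] is fixed by [(n - m)!] permutations. *)
Lemma sum_bin_fixpts n m : (m <= n)%N ->
  ((\sum_(s : 'S_n) 'C(#|fixpts s|, m)) * m`! = n`!)%N.
Proof.
move=> le_mn.
have -> : (\sum_(s : 'S_n) 'C(#|fixpts s|, m) =
    \sum_(s : 'S_n) \sum_(D : {set 'I_n} | #|D| == m) (D \subset fixpts s))%N.
  apply: eq_bigr => s _; rewrite -cards_draws -sum1dep_card.
  rewrite big_mkcondl [RHS]big_mkcond [LHS]big_mkcond.
  by apply: eq_bigr => D _; case: (_ \subset _).
rewrite exchange_big /=.
rewrite (eq_bigr (fun=> (n - m)`!)) => [|D /eqP cardD].
  have := card_draws 'I_n m; rewrite card_ord cardsE sum_nat_const => ->.
  by rewrite -mulnA [((_)`! * m`!)%N]mulnC bin_fact.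
have -> : (n - m)%N = #|~: D|.
  by rewrite -cardD -[X in (X - _)%N](card_ord n) -(cardsC D) addKn.
rewrite -card_perm -sum1_card [RHS]big_mkcond /=; apply: eq_bigr => s _.
have -> : (D \subset fixpts s) = (s \in perm_on (~: D)).
  apply/subsetP/subsetP => H x.
    by rewrite inE => sx; rewrite inE; apply: contra sx => /H; rewrite inE.
  by move=> xD; rewrite inE; apply/idPn => /H; rewrite inE xD.
by case: (_ \in _).
Qed.

(* The Bonferroni bound [x = k] >= C(x,k) - (k+1) C(x,k+1) + C(k+2,2) C(x,k+2)
   - C(k+3,3) C(x,k+3), rearranged to avoid truncated subtraction. *)
Lemma bonferroni3 (k x : nat) :
  ('C(x, k) + 'C(k.+2, 2) * 'C(x, k.+2) <=
   (x == k) + k.+1 * 'C(x, k.+1) + 'C(k.+3, 3) * 'C(x, k.+3))%N.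
Proof.
have [lt_xk|] := ltnP x k; first by rewrite !(@bin_small x) ?muln0 //; lia.
move/subnK=> <-; move: (x - k)%N => y {x}.
have E j : ('C(k + j, j) * 'C(y + k, k + j) = 'C(y + k, k) * 'C(y, j))%N.
  have [le_jy|lt_yj] := leqP j y; last first.
    by rewrite (@bin_small y) // (@bin_small (y + k)) ?muln0 //; lia.
  apply/eqP; rewrite -(@eqn_pmul2r (k`! * j`! * (y - j)`!)%N);
    last by rewrite !muln_gt0 !fact_gt0.
  have := bin_fact (leq_addl k j); rewrite addnK => E1.
  have := @bin_fact (y + k) (k + j).
  rewrite (_ : y + k - (k + j) = y - j)%N; last by lia.
  move=> /(_ ltac:(lia)) E2.
  have := bin_fact (leq_addl y k); rewrite addnK => E3.
  have E4 := bin_fact le_jy.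
  by apply/eqP; nia.
have := E 2%N; have := E 3%N; have := E 1%N.
rewrite !addn1 addn2 addn3 !bin1 => -> -> ->.
case: y E => [|y] _; first by rewrite !bin0n add0n binn eqxx.
have -> : (y.+1 + k == k)%N = false by lia.
(* This is what remains after dividing by ['C(y.+1 + k, k)]; by Pascal's rule the two sides differ
   by ['C(y, 3)]. *)
have : ('C(y.+1, 2) + 1 <= y.+1 + 'C(y.+1, 3))%N.
  by rewrite (binS y 1) bin1 (binS y 2); lia.
move: 'C(y.+1, 2) 'C(y.+1, 3) 'C(y.+1 + k, k) => c2 c3 c; nia.
Qed.

Lemma card_perms_with_fixpts_ge n k : (k + 3 <= n)%N ->
  (n`! <= 3 * k`! * #|perms_with_fixpts n k|)%N.
Proof.
move=> le_kn.
pose b (s : 'S_n) j := 'C(#|fixpts s|, j).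
have : (\sum_s (b s k + 'C(k.+2, 2) * b s k.+2) <=
        \sum_s ((#|fixpts s| == k) + k.+1 * b s k.+1 +
                'C(k.+3, 3) * b s k.+3))%N.
  by apply: leq_sum => s _; apply: bonferroni3.
rewrite /b !big_split /= -!big_distrr /=.
have -> : (\sum_(s : 'S_n) (#|fixpts s| == k) = #|perms_with_fixpts n k|)%N.
  rewrite -sum1dep_card [RHS]big_mkcond.
  by apply: eq_bigr => s _; case: (_ == _).
have := @sum_bin_fixpts n k ltac:(lia).
have := @sum_bin_fixpts n k.+1 ltac:(lia).
have := @sum_bin_fixpts n k.+2 ltac:(lia).
have := @sum_bin_fixpts n k.+3 ltac:(lia).
have := @bin_fact k.+2 2 ltac:(lia); have := @bin_fact k.+3 3 ltac:(lia).
rewrite !subSS !subn0 (_ : 2`! = 2)%N // (_ : 3`! = 6)%N //.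
set S3 := (\sum_s _)%N; set S2 := (\sum_s _)%N.
set S1 := (\sum_s _)%N; set S0 := (\sum_s _)%N.
set c3 := 'C(_, _); set c2 := 'C(_, _).
move: (#|_|) => w. rewrite !factS; have := fact_gt0 k.
move: (k`!) (n`!) S0 S1 S2 S3 c2 c3 => F N S0 S1 S2 S3 c2 c3.
move=> F0 E3 E2 M3 M2 M1 M0 H.
have {}E2 : (c2 * 2 = k.+2 * k.+1)%N.
  by apply/eqP; rewrite -(eqn_pmul2r F0); apply/eqP; lia.
have {}E3 : (c3 * 6 = k.+3 * (k.+2 * k.+1))%N.
  by apply/eqP; rewrite -(eqn_pmul2r F0); apply/eqP; lia.
(* Multiplied by [6 * F], the four binomial terms of [H] become [6N], [3N] on the left and [6N], [N]
   on the right, so [2 * N <= 6 * F * w]. *)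
have : (6 * c2 * S2 * F = 3 * N)%N by nia.
have : (6 * c3 * S3 * F = N)%N by nia.
nia.
Qed.

(** * Two-point correlations over the symmetric group *)

Definition correlation (R : realFieldType) n (A B : 'M[R]_n)
    (u v i j : 'I_n) : R :=
  \sum_(p : 'S_n) B (p u) (p v) * A (p i) (p j).

(** Substituting [t * p] for [p] shows that, for fixed [u] and [v], the correlation depends only on
    how [i] and [j] are placed relative to them. *)
Lemma correlation_perm (R : realFieldType) n (A B : 'M[R]_n) (t : 'S_n)
    u v i j :
  correlation A B (t u) (t v) (t i) (t j) = correlation A B u v i j.
Proof.
rewrite /correlation [RHS](reindex_inj (mulgI t)).
by apply: eq_bigr => p _; rewrite !permM.
Qed.

Lemma perm_2trans n (i j u v : 'I_n) : i != j -> u != v ->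
  exists t : 'S_n, t i = u /\ t j = v.
Proof.
move=> ij uv; exists (tperm i u * tperm (tperm i u j) v)%g.
rewrite !permM tpermL tpermL; split=> //.
have ju : tperm i u j != tperm i u i by rewrite (inj_eq perm_inj) eq_sym.
by rewrite tpermL in ju; rewrite (tpermD ju) // eq_sym.
Qed.

Lemma sum_offdiag (R : zmodType) n (F : 'I_n -> 'I_n -> R) :
  \sum_i \sum_(j | j != i) F i j = \sum_i \sum_j F i j - \sum_i F i i.
Proof.
rewrite -sumrB; apply: eq_bigr => i _.
by rewrite [X in X - _](bigD1 i) //= [X in X - _]addrC addrK.
Qed.

Lemma sum_offdiag_const (R : pzRingType) n (x : R) :
  \sum_(i < n) \sum_(j < n | j != i) x = n%:R * (n%:R - 1) * x.
Proof.
rewrite sum_offdiag !sumr_const card_ord -(mulr_natl (x *+ n)) -(mulr_natl x).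
by rewrite -mulrA mulrBl mul1r mulrBr.
Qed.

(* [h i j] is [h u v], [- h u v / (n - 2)] or [2 * h u v / ((n - 2) * (n - 3))]
   according to whether [{i, j}] meets [{u, v}] in 2, 1 or 0 points; the formula
   interpolates these three values so that it can be summed over [i] and [j]. *)
Lemma two_point_formula (R : realFieldType) n (u v : 'I_n)
    (h : 'I_n -> 'I_n -> R) :
  (4 <= n)%N -> u != v ->
  (forall i j, h i j = h j i) -> (forall i, h i i = 0) ->
  (forall i, \sum_j h i j = 0) ->
  (forall i j l, i != j -> i != l -> j != u -> j != v -> l != u -> l != v ->
     h i j = h i l) ->
  forall i j, i != j ->
  (n%:R - 2) * (n%:R - 3) * h i j = h u v *
    (2 - (n%:R - 1) * ((i == u)%:R + (i == v)%:R + (j == u)%:R + (j == v)%:R)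
       + (n%:R - 1) * (n%:R - 2) *
         ((i == u)%:R * (j == v)%:R + (i == v)%:R * (j == u)%:R)).
Proof.
move=> n4 uv sym diag row inv.
have vu : v != u by rewrite eq_sym.
have card2 : #|[pred k | (k != u) && (k != v)]|%:R = n%:R - 2 :> R.
  suff : (#|[pred k | (k != u) && (k != v)]| + 2)%N = n.
    by move/(congr1 (fun m => m%:R : R)); rewrite natrD; lra.
  have := cardC [set u; v]; rewrite cards2 uv card_ord addnC => E.
  rewrite -[RHS]E; congr (_ + _)%N; apply: eq_card => k.
  by rewrite !inE negb_or.
(* In row [u] the [n - 2] entries outside columns [u] and [v] are equal by [inv], and the row sums
   to zero. [rowv] and [rowo] argue in the same way, [rowo] also setting column [i] apart. *)
have rowu j : j != u -> j != v -> (n%:R - 2) * h u j = - h u v.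
  move=> ju jv; have := row u; rewrite (bigD1 u) //= diag (bigD1 v) //=.
  rewrite (eq_bigr (fun=> h u j)) => [|l /andP[lu lv]]; last first.
    by rewrite (inv u l j) // eq_sym.
  rewrite sumr_const -[_ *+ _]mulr_natl card2; lra.
have rowv j : j != u -> j != v -> (n%:R - 2) * h v j = - h u v.
  move=> ju jv; have := row v; rewrite (bigD1 u) //= (bigD1 v) //= diag.
  rewrite (eq_bigr (fun=> h v j)) => [|l /andP[lu lv]]; last first.
    by rewrite (inv v l j) // eq_sym.
  rewrite sumr_const -[_ *+ _]mulr_natl card2 [h v u]sym; lra.
have rowo i j : i != u -> i != v -> j != u -> j != v -> i != j ->
    (n%:R - 2) * (n%:R - 3) * h i j = 2 * h u v.
  move=> iu iv ju jv ij; have := row i.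
  rewrite (bigD1 u) //= (bigD1 v) //= (bigD1 i) ?iu //= diag.
  rewrite (eq_bigr (fun=> h i j)) => [|l /andP[/andP[lu lv] li]]; last first.
    by rewrite (inv i l j) // eq_sym.
  rewrite sumr_const -[_ *+ _]mulr_natl.
  have : #|[pred k | (k != u) && (k != v) && (k != i)]|%:R = n%:R - 3 :> R.
    have := card2; rewrite (cardD1 i) !inE iu iv /= natrD.
    rewrite (@eq_card _ _ [pred k | (k != u) && (k != v) && (k != i)]).
      lra.
    by move=> k; rewrite !inE andbC.
  move=> -> E; have := rowu i iu iv; have := rowv i iu iv.
  rewrite [h u i]sym [h v i]sym => E1 E2.
  have : (n%:R - 2) * (h i u + (h i v + (0 + (n%:R - 3) * h i j))) = 0 :> R.
    by rewrite E mulr0.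
  lra.
move=> i j.
have [->|iu] := eqVneq i u; have [->|jv] := eqVneq j v;
  rewrite ?(negbTE uv) ?(negbTE vu) ?eqxx //=.
- by move=> _; ring.
- move=> uj; have ju : j != u by rewrite eq_sym.
  rewrite (negbTE ju) /= [_ * (n%:R - 3)]mulrC -[LHS]mulrA rowu //=; ring.
- move=> iv; rewrite (negbTE iv) [h i v]sym.
  rewrite [_ * (n%:R - 3)]mulrC -[LHS]mulrA rowv //=; ring.
have [->|iv] := eqVneq i v; have [->|ju] := eqVneq j u;
  rewrite ?(negbTE uv) ?(negbTE vu) ?eqxx //=.
- by move=> _; rewrite [h v u]sym; ring.
- move=> vj; rewrite [_ * (n%:R - 3)]mulrC -[LHS]mulrA rowv //=; ring.
- move=> _; rewrite [h i u]sym [_ * (n%:R - 3)]mulrC -[LHS]mulrA rowu //=; ring.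
by move=> ij; rewrite rowo //=; ring.
Qed.

Lemma sum_eq_perm (R : nmodType) n (w : 'S_n) (i : 'I_n) (F : 'I_n -> R) :
  \sum_j F j *+ (i == w j) = F ((w^-1)%g i).
Proof.
rewrite (bigD1 ((w^-1)%g i)) //= permKV eqxx big1 ?addr0 // => j.
by rewrite eq_sym -(inj_eq (@perm_inj _ w)) permKV => /negbTE->.
Qed.

(** * Averages of [qap] for a hollow symmetric matrix with zero row sums *)

Section ZeroSums.
Variables (R : realFieldType) (n : nat) (A : 'M[R]_n).
Hypotheses (n4 : (4 <= n)%N) (A_sym : symmetric_mx A).
Hypotheses (A_diag : forall i, A i i = 0) (A_rows : forall i, \sum_j A i j = 0).

Let corr_hollow (B : 'M[R]_n) u v i : correlation A B u v i i = 0.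
Proof. by apply: big1 => p _; rewrite A_diag mulr0. Qed.

Let corr_formula (B : 'M[R]_n) u v i j : u != v -> i != j ->
  (n%:R - 2) * (n%:R - 3) * correlation A B u v i j =
  correlation A B u v u v *
    (2 - (n%:R - 1) * ((i == u)%:R + (i == v)%:R + (j == u)%:R + (j == v)%:R)
       + (n%:R - 1) * (n%:R - 2) *
         ((i == u)%:R * (j == v)%:R + (i == v)%:R * (j == u)%:R)).
Proof.
move=> uv; apply: (two_point_formula (h := correlation A B u v)) => //.
- by move=> a b; apply: eq_bigr => p _; rewrite A_sym.
- move=> a; rewrite exchange_big big1 //= => p _.
  rewrite -mulr_sumr; have := A_rows (p a).
  by rewrite (reindex_inj (@perm_inj _ p)) /= => ->; rewrite mulr0.
move=> a b c ab ac bu bv cu cv.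
(* The transposition of [b] and [c] fixes [u], [v] and [a]. *)
rewrite -(correlation_perm A B (tperm b c) u v a b).
by rewrite tpermL !(@tpermD _ b c) // eq_sym.
Qed.

Let corr_diag (B : 'M[R]_n) (i j u v : 'I_n) : i != j -> u != v ->
  correlation A B i j i j = correlation A B u v u v.
Proof.
move=> ij uv; have [t [<- <-]] := perm_2trans ij uv.
by rewrite correlation_perm.
Qed.

(** By double transitivity the [n (n - 1)] ordered pairs of distinct indices have the same
    correlation; in their total, each [p] contributes [qap A B 1]. *)
Let sum_corr_diag (B : 'M[R]_n) (u v : 'I_n) : u != v ->
  n%:R * (n%:R - 1) * correlation A B u v u v = n`!%:R * qap A B 1%g.
Proof.
move=> uv.
have <- : \sum_i \sum_(j | j != i) correlation A B i j i j =
          n%:R * (n%:R - 1) * correlation A B u v u v.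
  have -> : \sum_(i < n) \sum_(j < n | j != i) correlation A B i j i j =
      \sum_(i < n) \sum_(j < n | j != i) correlation A B u v u v.
    apply: eq_bigr => i _; apply: eq_bigr => j ji.
    by apply: corr_diag; rewrite // eq_sym.
  by rewrite sum_offdiag_const.
rewrite sum_offdiag [X in _ - X]big1 ?subr0 => [|i _]; last exact: corr_hollow.
transitivity (\sum_(p : 'S_n) qap A B 1%g); last first.
  by rewrite sumr_const card_Sn mulr_natl.
under eq_bigr do rewrite exchange_big /=.
rewrite exchange_big /=; apply: eq_bigr => p _.
rewrite /qap [RHS](reindex_inj (@perm_inj _ p)); apply: eq_bigr => i _.
rewrite [RHS](reindex_inj (@perm_inj _ p)); apply: eq_bigr => j _.
by rewrite !perm1.
Qed.

(** [w ^ p] sends [p i] to [p (w i)], so relabelling by [p] turns the sum over conjugates into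
    correlations at [u = w i], [v = w j]. *)
Let sum_conj (B : 'M[R]_n) (w : 'S_n) :
  \sum_(p : 'S_n) qap A B (w ^ p)%g =
  \sum_i \sum_(j | j != i) correlation A B (w i) (w j) i j.
Proof.
rewrite sum_offdiag [X in _ - X]big1 ?subr0 => [|i _]; last exact: corr_hollow.
under [RHS]eq_bigr do rewrite exchange_big /=.
rewrite [RHS]exchange_big /=; apply: eq_bigr => p _.
rewrite /qap (reindex_inj (@perm_inj _ p)); apply: eq_bigr => i _.
rewrite (reindex_inj (@perm_inj _ p)); apply: eq_bigr => j _.
by rewrite !permJ.
Qed.

(* An inequality only because the contribution of the two-cycles of [w], which
   is nonnegative, is dropped. *)
Lemma sum_qap_conj_ge (B : 'M[R]_n) (w : 'S_n) (c := #|fixpts w|%:R : R) :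
  0 <= qap A B 1%g ->
  n`!%:R * (c ^+ 2 - 3 * c) * qap A B 1%g <=
  (n%:R ^+ 2 - 3 * n%:R) * \sum_(p : 'S_n) qap A B (w ^ p)%g.
Proof.
move=> q0; rewrite sum_conj.
have n4R : 4 <= n%:R :> R by rewrite (ler_nat R 4).
have [u [v uv]] : exists u v : 'I_n, u != v.
  exists (Ordinal (leq_trans (isT : 0 < 4)%N n4)).
  by exists (Ordinal (leq_trans (isT : 1 < 4)%N n4)).
set g := correlation A B u v u v.
have Eg : n%:R * (n%:R - 1) * g = n`!%:R * qap A B 1%g by apply: sum_corr_diag.
have g0 : 0 <= g.
  have : 0 <= n%:R * (n%:R - 1) * g by rewrite Eg mulr_ge0 ?ler0n.
  by rewrite pmulr_rge0 //; apply: mulr_gt0; lra.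
(* The indicator terms of [two_point_formula] at [u = w i], [v = w j]. Over [j != i], [e] counts
   ordered pairs of fixed points and [e'] counts each two-cycle of [w] twice. *)
pose x (i j : 'I_n) : R :=
  (i == w i)%:R + (i == w j)%:R + (j == w i)%:R + (j == w j)%:R.
pose e (i j : 'I_n) : R := (i == w i)%:R * (j == w j)%:R.
pose e' (i j : 'I_n) : R := (i == w j)%:R * (j == w i)%:R.
have fixE i : (i == w i) = (i \in fixpts w) by rewrite inE eq_sym.
have sfix : \sum_i (i == w i)%:R = c.
  rewrite /c -sum1_card natr_sum [RHS]big_mkcond.
  by apply: eq_bigr => i _; rewrite fixE; case: (_ \in _).
have Sx : \sum_i \sum_(j | j != i) x i j = 2 * (n%:R + c * (n%:R - 2)).
  have S1 : \sum_(i < n) \sum_(j < n) (i == w j)%:R = n%:R :> R.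
    under eq_bigr => i _ do rewrite (sum_eq_perm w i (fun=> 1)).
    by rewrite sumr_const card_ord.
  have S2 : \sum_(i < n) \sum_(j < n) (i == w i)%:R = n%:R * c :> R.
    under eq_bigr => i _ do rewrite sumr_const card_ord -[_ *+ n]mulr_natl.
    by rewrite -mulr_sumr sfix.
  rewrite sum_offdiag /x; under eq_bigr do rewrite !big_split /=.
  rewrite !big_split /= S1 S2.
  rewrite [X in _ + _ + X + _ - _]exchange_big /= S1.
  rewrite [X in _ + _ + _ + X - _]exchange_big /= S2 sfix; ring.
have Se : \sum_i \sum_(j | j != i) e i j = c ^+ 2 - c.
  rewrite sum_offdiag /e -{2}sfix; congr (_ - _).
    by under eq_bigr do rewrite -mulr_sumr sfix; rewrite -mulr_suml sfix expr2.
  by apply: eq_bigr => i _; case: eqP; rewrite ?mulr1 ?mulr0.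
have Se' : 0 <= \sum_i \sum_(j | j != i) e' i j.
  by do 2![apply: sumr_ge0 => ? _]; rewrite mulr_ge0 ?ler0n.
set S := \sum_i _.
have ES : (n%:R - 2) * (n%:R - 3) * S = g * (2 * (n%:R * (n%:R - 1))
    - (n%:R - 1) * \sum_i \sum_(j | j != i) x i j
    + (n%:R - 1) * (n%:R - 2) * (\sum_i \sum_(j | j != i) e i j +
                                 \sum_i \sum_(j | j != i) e' i j)).
  have -> : 2 * (n%:R * (n%:R - 1)) = \sum_(i < n) \sum_(j < n | j != i) 2 :> R.
    by rewrite sum_offdiag_const mulrC.
  rewrite /S !mulr_sumr -big_split /= mulr_sumr -sumrB -big_split /= mulr_sumr.
  apply: eq_bigr => i _.
  rewrite !mulr_sumr -big_split /= mulr_sumr -sumrB -big_split /= mulr_sumr.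
  apply: eq_bigr => j; rewrite eq_sym => ij.
  have wij : w i != w j by rewrite (inj_eq perm_inj).
  by rewrite corr_formula // (corr_diag B wij uv).
move: ES Se'; rewrite Sx Se; set t := \sum_i _ => ES t0.
(* The two terms [2 n (n - 1)] cancel, and the rest has the common factor [(n - 1) (n - 2)]. *)
have {}ES : (n%:R - 2) *
    ((n%:R - 3) * S - g * (n%:R - 1) * (c ^+ 2 - 3 * c + t)) = 0.
  by rewrite mulrBr mulrA ES; ring.
have {}ES : (n%:R - 3) * S = g * (n%:R - 1) * (c ^+ 2 - 3 * c + t).
  by move/eqP: ES; rewrite mulf_eq0 subr_eq0 => /orP[/eqP|/eqP]; lra.
rewrite mulrAC -Eg (_ : (_ - _) * S = n%:R * ((n%:R - 3) * S)); last by ring.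
rewrite ES -subr_ge0 (_ : _ - _ = n%:R * (n%:R - 1) * g * t); last by ring.
by rewrite !mulr_ge0 //; lra.
Qed.

(** By double transitivity [K] is constant off the diagonal, where alone [A] can be nonzero, so each
    row contributes a multiple of its zero sum. *)
Lemma perm_mean_qap0 (B : 'M[R]_n) : perm_mean (qap A B) = 0.
Proof.
pose K i j := \sum_(s : 'S_n) B (s i) (s j).
have Kconst i j u v : i != j -> u != v -> K i j = K u v.
  move=> ij uv; have [t [<- <-]] := perm_2trans ij uv.
  by rewrite /K (reindex_inj (mulgI t)); apply: eq_bigr => s _; rewrite !permM.
rewrite /perm_mean (_ : \sum_s _ = 0) ?mulr0 //.
rewrite /qap exchange_big /=.
transitivity (\sum_i \sum_j K i j * A i j).
  apply: eq_bigr => i _; rewrite exchange_big.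
  by apply: eq_bigr => j _; rewrite mulr_suml.
pose u := Ordinal (leq_trans (isT : 0 < 4)%N n4).
pose v := Ordinal (leq_trans (isT : 1 < 4)%N n4).
apply: big1 => i _; transitivity (\sum_j K u v * A i j).
  apply: eq_bigr => j _; have [->|ij] := eqVneq i j.
    by rewrite A_diag !mulr0.
  by rewrite (Kconst i j u v).
by rewrite -mulr_sumr A_rows mulr0.
Qed.

(** Relabelling [B] by [tau] moves [tau] to the identity. The permutations with [k] fixed points are
    stable under conjugation, so their sum may be averaged over conjugates. *)
Lemma sum_qap_fixpts_ge (B : 'M[R]_n) (tau : 'S_n) (k : nat) :
  0 <= qap A B tau ->
  #|perms_with_fixpts n k|%:R * (beta R n k * qap A B tau) <=
  \sum_(w in perms_with_fixpts n k) qap A B (w * tau)%g.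
Proof.
move=> q0; pose B' := \matrix_(i, j) B (tau i) (tau j).
have qE w : qap A B (w * tau)%g = qap A B' w.
  by do 2![apply: eq_bigr => ? _]; rewrite mxE !permM.
have q1 : qap A B tau = qap A B' 1%g by rewrite -qE mul1g.
rewrite q1 in q0 *; under [leRHS]eq_bigr do rewrite qE.
have n4R : 4 <= n%:R :> R by rewrite (ler_nat R 4).
have nn0 : 0 < n%:R ^+ 2 - 3 * n%:R :> R.
  by rewrite expr2 -mulrBl; apply: mulr_gt0; lra.
have avg : n`!%:R * \sum_(w in perms_with_fixpts n k) qap A B' w =
    \sum_(w in perms_with_fixpts n k) \sum_(p : 'S_n) qap A B' (w ^ p)%g.
  transitivity (\sum_(p : 'S_n) \sum_(w in perms_with_fixpts n k) qap A B' w).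
    by rewrite sumr_const card_Sn mulr_natl.
  rewrite [RHS]exchange_big /=; apply: eq_bigr => p _.
  rewrite (reindex_inj (@conjg_inj _ p)).
  by apply: eq_bigl => w; rewrite !inE fixpts_conj.
have nf0 : 0 < n`!%:R :> R by rewrite ltr0n fact_gt0.
rewrite -(ler_pM2l nf0) avg -(ler_pM2l nn0) [leRHS]mulr_sumr.
rewrite [leLHS](_ : _ = \sum_(w in perms_with_fixpts n k)
   (n`!%:R * (k%:R ^+ 2 - 3 * k%:R) * qap A B' 1%g)); last first.
  rewrite sumr_const -[RHS]mulr_natl /beta; field; lra.
apply: ler_sum => w; rewrite inE => /eqP wk.
by have := sum_qap_conj_ge w q0; rewrite wk.
Qed.

End ZeroSums.

(** * Reduction to zero row sums, and the final count *)

Lemma centered_qap_zero_sums (R : realFieldType) n (A B : 'M[R]_n) :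
  (4 <= n)%N -> symmetric_mx A -> constant_row_col_sums A ->
  constant_diagonal A ->
  exists A' : 'M[R]_n,
    [/\ symmetric_mx A', forall i, A' i i = 0, forall i, \sum_j A' i j = 0 &
        forall s, centered (qap A B) s = qap A' B s].
Proof.
move=> n4 symA [a [_ rowA]] [b diagA].
have n4R : 4 <= n%:R :> R by rewrite (ler_nat R 4).
(* Chosen so that each row of [D] sums to [b + (n - 1) c = a]. *)
pose c := (a - b) / (n%:R - 1).
pose D (i j : 'I_n) := if i == j then b else c.
pose A' : 'M[R]_n := \matrix_(i, j) (A i j - D i j).
have symA' : symmetric_mx A' by move=> i j; rewrite !mxE symA /D eq_sym.
have diagA' i : A' i i = 0 by rewrite mxE /D eqxx diagA subrr.
have rowA' i : \sum_j A' i j = 0.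
  under eq_bigr do rewrite mxE.
  rewrite sumrB rowA (bigD1 i) //= /D eqxx.
  rewrite (eq_bigr (fun=> c)) => [|j /negbTE ji]; last by rewrite eq_sym ji.
  rewrite sumr_const cardC1 card_ord -[c *+ _]mulr_natl.
  rewrite -subn1 natrB ?(leq_trans _ n4) // /c; field; lra.
exists A'; split=> // s.
pose K := \sum_i \sum_j B i j * D i j.
(* [D i j] depends only on whether [i = j], so its contribution [K] is the same for every [t]. *)
have qE t : qap A B t = qap A' B t + K.
  rewrite /K [X in _ + X](reindex_inj (@perm_inj _ t)) -big_split.
  apply: eq_bigr => i _ /=.
  rewrite [X in _ + X](reindex_inj (@perm_inj _ t)) -big_split.
  apply: eq_bigr => j _ /=.
  by rewrite mxE /D (inj_eq perm_inj) -mulrDr subrK.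
rewrite /centered /perm_mean; under eq_bigr do rewrite qE.
rewrite big_split /= mulrDr -/(perm_mean _) perm_mean_qap0 // add0r.
rewrite sumr_const card_Sn -[K *+ _]mulr_natl mulKf ?qE ?addrK //.
by rewrite pnatr_eq0 -lt0n fact_gt0.
Qed.

(** A reverse Markov inequality: on [W], [F] is at most [M] inside [G] and below [g * m * M] outside
    it, so an average of at least [m * M] forces [G] to be large. *)
Lemma card_ge_average (R : realFieldType) (T : finType) (W : {set T})
    (F : T -> R) (M m g : R) :
  0 < M -> 0 <= g * m -> (forall x, F x <= M) ->
  #|W|%:R * (m * M) <= \sum_(x in W) F x ->
  (1 - g) * m * #|W|%:R <= #|[set x | g * m * M <= F x]|%:R.
Proof.
move=> M0 gm0 FM avg; pose G := [set x | g * m * M <= F x].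
have bound : \sum_(x in W) F x <= M * #|G|%:R + #|W|%:R * (g * m * M).
  apply: (@le_trans _ _ (\sum_(x in W) (M * (x \in G)%:R + g * m * M))).
    apply: ler_sum => x _; rewrite inE; have [le|lt] := lerP (g * m * M) (F x).
      by rewrite mulr1 (le_trans (FM x)) // lerDl mulr_ge0 // ltW.
    by rewrite mulr0 add0r ltW.
  rewrite big_split /= sumr_const mulr_natl lerD2r -mulr_sumr ler_pM2l //.
  rewrite -sum1_card natr_sum [leRHS]big_mkcond [leLHS]big_mkcond.
  by apply: ler_sum => x _; do 2!case: (_ \in _).
rewrite -(ler_pM2l M0); have := le_trans avg bound; lra.
Qed.

Theorem theorem2p3 (R : realFieldType) (n k : nat) (A B : 'M[R]_n)
    (tau : 'S_n) (gamma : R)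
    (A_sym : symmetric_mx A)
    (A_sums : constant_row_col_sums A)
    (A_diag : constant_diagonal A)
    (tau_max : forall s : 'S_n,
      centered (qap A B) s <= centered (qap A B) tau)
    (k_ge3 : (3 <= k)%N) (k_len5 : (k + 5 <= n)%N)
    (gamma_gt0 : 0 < gamma) (gamma_lt1 : gamma < 1) :
  (1 - gamma) * beta R n k / (3 * k`!%:R)
  <= perm_prob R (fun s : 'S_n =>
       gamma * beta R n k * centered (qap A B) tau <= centered (qap A B) s).
Proof.
have n4 : (4 <= n)%N by lia.
have [A' [symA' diagA' rowA' fE]] :=
  centered_qap_zero_sums B n4 A_sym A_sums A_diag.
have {}tau_max s : qap A' B s <= qap A' B tau by rewrite -!fE.
have -> : perm_prob R (fun s => gamma * beta R n k * centered (qap A B) tau <=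
      centered (qap A B) s) =
    #|[set s | gamma * beta R n k * qap A' B tau <= qap A' B s]|%:R / n`!%:R.
  rewrite /perm_prob card_Sn; congr (_%:R / _).
  by apply: eq_card => s; rewrite !inE !fE.
have nf0 : 0 < n`!%:R :> R by rewrite ltr0n fact_gt0.
have kf1 : 1 <= k`!%:R :> R by rewrite (ler_nat R 1) fact_gt0.
have k3R : 3 <= k%:R :> R by rewrite (ler_nat R 3).
have knR : k%:R + 5 <= n%:R :> R by rewrite -(natrD R k 5) ler_nat.
have nn0 : 0 < n%:R ^+ 2 - 3 * n%:R :> R by rewrite expr2 -mulrBl mulr_gt0; lra.
have beta0 : 0 <= beta R n k.
  by rewrite divr_ge0 ?(ltW nn0) // expr2 -mulrBl mulr_ge0; lra.
have beta1 : beta R n k <= 1.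
  by rewrite ler_pdivrMr // mul1r; nra.
have sum0 : \sum_s qap A' B s = 0.
  have := perm_mean_qap0 n4 diagA' rowA' B.
  by move/eqP; rewrite mulf_eq0 invr_eq0 (gt_eqF nf0) => /eqP.
have sumM : \sum_s (qap A' B tau - qap A' B s) = n`!%:R * qap A' B tau.
  by rewrite sumrB sum0 subr0 sumr_const card_Sn mulr_natl.
have M0 : 0 <= qap A' B tau.
  rewrite -(pmulr_rge0 _ nf0) -sumM.
  by apply: sumr_ge0 => s _; rewrite subr_ge0.
rewrite ler_pdivlMr //.
(* If the maximum is zero, the mean-zero function vanishes identically: the event is certain, and
   the claimed bound is at most 1. *)
have [Mz|Mn0] := eqVneq (qap A' B tau) 0.
  have f0 s : qap A' B s = 0.
    move/eqP: sumM; rewrite Mz mulr0 psumr_eq0; last first.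
      by move=> t _; rewrite subr_ge0 -Mz.
    by move/allP/(_ s); rewrite mem_index_enum sub0r oppr_eq0 => /(_ isT)/eqP.
  rewrite (_ : [set s | _] = setT) ?cardsT ?card_Sn; last first.
    by apply/setP=> s; rewrite !inE Mz mulr0 f0 lexx.
  rewrite ler_piMl ?(ltW nf0) // ler_pdivrMr ?mul1r; last lra.
  nra.
have Mgt0 : 0 < qap A' B tau by rewrite lt_neqAle eq_sym Mn0.
(* The product applies [w] first, so [w * tau] agrees with [tau] exactly at the fixed points of
   [w]. *)
pose W := [set (w * tau)%g | w in perms_with_fixpts n k].
have cardW : #|W| = #|perms_with_fixpts n k|.
  by rewrite card_imset //; apply: mulIg.
have avg : #|W|%:R * (beta R n k * qap A' B tau) <= \sum_(s in W) qap A' B s.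
  rewrite cardW big_imset /=; last by move=> s t _ _; apply: mulIg.
  exact: sum_qap_fixpts_ge.
apply: le_trans (card_ge_average Mgt0 _ tau_max avg);
  last by rewrite mulr_ge0 // ltW.
have gb0 : 0 <= (1 - gamma) * beta R n k by rewrite mulr_ge0 // subr_ge0 ltW.
rewrite -[leLHS]mulrA; apply: (ler_wpM2l gb0).
rewrite [leLHS]mulrC ler_pdivrMr; last by rewrite mulr_gt0 // ltr0n fact_gt0.
rewrite cardW mulrC -!natrM ler_nat; apply: card_perms_with_fixpts_ge.
by apply: leq_trans k_len5; rewrite leq_add2l.
Qed.
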